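(* Let $a$ be an element of a unital Banach algebra $A$ with $\mathrm{Sp}(a)$ containing no negative real numbers nor $0$. Suppose that $X_0\in\{a\}'$ (the commutant of $a$ in $A$) with $\mathrm{Sp}(a^{-1/2}X_0)$ contained in the open right half plane. Then the Newton iterates $X_{k+1}=\frac12(X_k+X_k^{-1}a)$ (for $k\ge0$) converge quadratically to $a^{1/2}$, and also $X_k^{-1}\to a^{-1/2}$, with $$\|X_{k+1}-a^{1/2}\|\le\tfrac12\,\|X_k^{-1}\|\,\|X_k-a^{1/2}\|^2 ,$$ and $$X_k=a^{1/2}(1-G_0^{2^k})^{-1}(1+G_0^{2^k})\,S\quad\text{for }k\ge1,$$ where $G_0=\kappa(N)$, $N=((a^{-1/2}X_0)^2)^{1/2}$, and $S=\mathrm{sign}(a^{-1/2}X_0)$.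
   Context: Algebras are complex; a unital Banach algebra has an identity of norm $1$. If $x$ has spectrum disjoint from $(-\infty,0]$, then $x^{1/2}$ denotes the principal square root: the unique square root of $x$ with spectrum in the open right half plane; and $x^{-1/2}=(x^{1/2})^{-1}$. If $\mathrm{Sp}(x)\cap i\mathbb{R}=\emptyset$, then $\mathrm{sign}(x)=x\,(x^2)^{-1/2}$. The Cayley transform is $\kappa(x)=(x-1)(x+1)^{-1}$. The quadratic convergence is in the sense expressed by the displayed inequality. *)

(* Defs.v *)
From HB Require Import structures.
From mathcomp Require Import all_boot all_order all_algebra.
From mathcomp Require Export complex.
From mathcomp Require Import all_classical all_reals all_analysis.

Set Implicit Arguments.
Unset Strict Implicit.
Unset Printing Implicit Defensive.

Import Order.TTheory GRing.Theory Num.Theory.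
Import numFieldNormedType.Exports.

Local Open Scope classical_set_scope.
Local Open Scope complex_scope.
Local Open Scope ring_scope.

(* Not an HB structure: Hierarchy Builder rejects a join of [NormedModule] and
   [NzRing], because [NumDomain] already inherits from both a normed Zmodule
   and a ring. The instances below give a Banach algebra its [unitAlgType] and
   [completeNormedModType] structures on the same carrier. *)
Record banachAlgType (K : numFieldType) := BanachAlg {
  banach_space : completeNormedModType K;
  banach_one : banach_space;
  banach_mul : banach_space -> banach_space -> banach_space;
  banach_mulA : associative banach_mul;
  banach_mul1l : left_id banach_one banach_mul;
  banach_mul1r : right_id banach_one banach_mul;
  banach_mulDl : left_distributive banach_mul +%R;
  banach_mulDr : right_distributive banach_mul +%R;
  banach_scaleAl : forall (k : K) x y,
    k *: banach_mul x y = banach_mul (k *: x) y;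
  banach_scaleAr : forall (k : K) x y,
    k *: banach_mul x y = banach_mul x (k *: y);
  banach_normM : forall x y, `|banach_mul x y| <= `|x| * `|y|;
  banach_norm1 : `|banach_one| = 1
}.

Definition banach_sort (K : numFieldType) (A : banachAlgType K) : Type :=
  banach_space A.
Coercion banach_sort : banachAlgType >-> Sortclass.

Section BanachAlgebraInstances.
Variables (K : numFieldType) (A : banachAlgType K).

HB.instance Definition _ :=
  CompleteNormedModule.copy (banach_sort A) (banach_space A).

Let banach_one_neq0 : banach_one A != 0.
Proof. by rewrite -normr_eq0 banach_norm1 oner_eq0. Qed.

HB.instance Definition _ := GRing.Zmodule_isNzRing.Build (banach_sort A)
  (@banach_mulA K A) (@banach_mul1l K A) (@banach_mul1r K A)
  (@banach_mulDl K A) (@banach_mulDr K A) banach_one_neq0.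

HB.instance Definition _ :=
  GRing.Lmodule_isLalgebra.Build K (banach_sort A) (@banach_scaleAl K A).

HB.instance Definition _ :=
  GRing.Lalgebra_isAlgebra.Build K (banach_sort A) (@banach_scaleAr K A).

Definition banach_unit : pred A :=
  fun x => `[< exists y : A, y * x = 1 /\ x * y = 1 >].

(* As required by [unitRingType], the inverse of a non-invertible [x] is [x]. *)
Definition banach_inv (x : A) : A :=
  xget x [set y | y * x = 1 /\ x * y = 1].

Let banach_mulVr : {in banach_unit, left_inverse 1 banach_inv *%R}.
Proof. by move=> x /asboolP/(xgetPex x)[]. Qed.

Let banach_mulrV : {in banach_unit, right_inverse 1 banach_inv *%R}.
Proof. by move=> x /asboolP/(xgetPex x)[]. Qed.

Let banach_unitP (x y : A) : y * x = 1 /\ x * y = 1 -> banach_unit x.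
Proof. by move=> xy; apply/asboolP; exists y. Qed.

Let banach_inv_out : {in [predC banach_unit], banach_inv =1 id}.
Proof.
move=> x /negP xNunit; apply: xgetPN => y xy.
by apply: xNunit; apply: banach_unitP xy.
Qed.

HB.instance Definition _ := GRing.NzRing_hasMulInverse.Build (banach_sort A)
  banach_mulVr banach_mulrV banach_unitP banach_inv_out.

Lemma banach_normrM (x y : A) : `|x * y| <= `|x| * `|y|.
Proof. exact: banach_normM. Qed.

Lemma banach_normr1 : `|1 : A| = 1.
Proof. exact: banach_norm1. Qed.

End BanachAlgebraInstances.

Definition spectrum (R : realType) (A : banachAlgType R[i]) (x : A) :
    set R[i] :=
  [set l | x - l%:A \isn't a GRing.unit].

Definition right_half_plane (R : realType) : set R[i] :=
  [set l | 0 < complex.Re l].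

Definition nonpos_reals (R : realType) : set R[i] :=
  [set r%:C | r in [set r : R | r <= 0]].

Definition is_psqrt (R : realType) (A : banachAlgType R[i]) (x y : A) : Prop :=
  y ^+ 2 = x /\ spectrum y `<=` @right_half_plane R.

(* Meaningful when the spectrum of [x] misses [nonpos_reals], in which case
   there is exactly one [y] such that [is_psqrt x y]; [0] is a dummy value. *)
Definition psqrt (R : realType) (A : banachAlgType R[i]) (x : A) : A :=
  xget 0 [set y | is_psqrt x y].

(* Meaningful when the spectrum of [x] misses the imaginary axis. *)
Definition signB (R : realType) (A : banachAlgType R[i]) (x : A) : A :=
  x * (psqrt (x ^+ 2))^-1.

(* Meaningful when [-1] is not in the spectrum of [x]. *)
Definition cayley (R : realType) (A : banachAlgType R[i]) (x : A) : A :=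
  (x - 1) * (x + 1)^-1.

Definition newton (R : realType) (A : banachAlgType R[i]) (a X0 : A)
    (k : nat) : A :=
  iter k (fun X => 2^-1 *: (X + X^-1 * a)) X0.

(* Main.v *)
Require Import Defs.
From HB Require Import structures.
From mathcomp Require Import all_boot all_order all_algebra.
From mathcomp Require Import all_classical all_reals all_analysis.
From mathcomp Require Import ring lra.

Set Implicit Arguments.
Unset Strict Implicit.
Unset Printing Implicit Defensive.

Import Order.TTheory GRing.Theory Num.Theory.
Import numFieldNormedType.Exports.

Local Open Scope classical_set_scope.
Local Open Scope complex_scope.
Local Open Scope ring_scope.

(* No functional calculus is needed. Newton's iteration for the square root of
   [a] started at [1] has iterates [X_k] equal to the mean of
   [a (a cos^2 v + sin^2 v)^-1] over [2^k] equally spaced angles [v], a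
   quadrature of an integral whose integrand is Lipschitz because the segment
   from [1] to [a] consists of invertible elements; so [X_k] is a Cauchy
   sequence, and its limit is a square root of [a]. Its spectrum is in the open
   right half-plane since the scalar iteration preserves the closed left
   half-plane. Conversely, if [x] has its spectrum in the open right half-plane,
   the iterates for [x^2] started at [1] tend to [x] (by continuation along the
   segment from [1] to [x]); this gives the uniqueness of principal roots, and,
   with [x = a^(-1/2) X_0], also the convergence of the given iteration, since
   it is [a^(1/2) N^k(x)] where [N(x) = (x + x^-1) / 2], and [x N^k(x)] is the
   iterate for [x^2] started at [1]. In particular [x] is its own principal
   root of [x^2], so that its sign is [1]. Finally [N] squares the Cayley
   transform. *)

(** * Comparison with geometric sequences *)

Lemma geometric_small (R : realType) (C q e : R) : 0 <= q < 1 -> 0 < e ->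
  exists K, forall k, (K <= k)%N -> C * q ^+ k < e.
Proof.
move=> /andP[q0 q1] e0; have q1' : `|q| < 1 by rewrite ger0_norm.
have /cvgrPdist_lt/(_ _ e0)[K _ CK] := cvg_geometric C q1'.
exists K => k /CK; rewrite /= sub0r normrN => /(le_lt_trans _); apply.
exact: ler_norm.
Qed.

(** Serves to prove equalities: a norm dominated by every [C * q ^+ k] vanishes. *)
Lemma geometric_le0 (R : realType) (r C q : R) : 0 <= q < 1 ->
  (forall k, r <= C * q ^+ k) -> r <= 0.
Proof.
move=> q01 rC; rewrite leNgt; apply/negP => r0.
have [K /(_ _ (leqnn K))] := geometric_small C q01 r0.
by rewrite ltNge rC.
Qed.

(** * The norm as a real number, and completeness *)

Section RealNorm.
Variables (R : realType) (A : banachAlgType R[i]).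
Implicit Types x y : A.

(** The norm of [A] has values in [R[i]]; its real part lives in [R], where the order is total. *)
Definition rnorm x : R := complex.Re `|x|.

Lemma rnormE x : `|x| = (rnorm x)%:C.
Proof.
have := normr_ge0 x; rewrite /rnorm; case: `|x| => u v.
by rewrite lecE /= => /andP[/eqP -> _].
Qed.

Lemma rnorm_ge0 x : 0 <= rnorm x.
Proof. by rewrite -lecR -rnormE normr_ge0. Qed.

Lemma rnorm0 : rnorm 0 = 0.
Proof. by rewrite /rnorm normr0. Qed.

Lemma rnorm_eq0 x : rnorm x = 0 -> x = 0.
Proof. by move=> x0; apply/normr0_eq0; rewrite rnormE x0. Qed.

Lemma rnorm1 : rnorm 1 = 1.
Proof. by rewrite /rnorm banach_normr1. Qed.

Lemma rnormD x y : rnorm (x + y) <= rnorm x + rnorm y.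
Proof. by rewrite -lecR rmorphD /= -!rnormE ler_normD. Qed.

Lemma rnormN x : rnorm (- x) = rnorm x.
Proof. by rewrite /rnorm normrN. Qed.

Lemma rnormM x y : rnorm (x * y) <= rnorm x * rnorm y.
Proof. by rewrite -lecR rmorphM /= -!rnormE banach_normrM. Qed.

Lemma rnormZ (k : R[i]) x : rnorm (k *: x) = complex.Re `|k| * rnorm x.
Proof.
have kE : `|k| = (complex.Re `|k|)%:C.
  by have := normr_ge0 k; case: `|k| => u v; rewrite lecE /= => /andP[/eqP ->].
by rewrite /rnorm normrZ kE rnormE -rmorphM.
Qed.

Lemma rnorm_cvg (x : nat -> A) (l : A) :
  (forall e : R, 0 < e -> exists K, forall k, (K <= k)%N -> rnorm (x k - l) < e)
  -> x k @[k --> \oo] --> l.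
Proof.
move=> xl; apply/cvgrPdist_lt => e e0.
have eE : e = (complex.Re e)%:C.
  by move: e0; case: e => u v; rewrite ltcE /= => /andP[/eqP ->].
have [|K xK] := xl (complex.Re e); first by rewrite -ltcR -eE.
by exists K => // k /xK; rewrite distrC rnormE [in X in _ -> X]eE ltcR.
Qed.

Lemma rnorm_real (r : R) x : rnorm (r%:C *: x) = `|r| * rnorm x.
Proof. by rewrite rnormZ normc_def /= expr0n /= addr0 sqrtr_sqr. Qed.

Lemma rnorm_le_geometric (x : nat -> A) (C q : R) : 0 <= q < 1 ->
  (forall k, rnorm (x k.+1 - x k) <= C * q ^+ k) ->
  forall k m, rnorm (x (k + m)%N - x k) <= C * q ^+ k / (1 - q).
Proof.
move=> /andP[q0 q1] xC k m.
have C0 : 0 <= C.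
  by have := le_trans (rnorm_ge0 _) (xC 0%N); rewrite expr0 mulr1.
(* The factor [1 - q ^+ m] of the partial geometric sum makes the induction on [m] close. *)
suff: rnorm (x (k + m)%N - x k) <= C * q ^+ k * (1 - q ^+ m) / (1 - q).
  move/le_trans; apply; apply: ler_wpM2r.
    by rewrite invr_ge0 subr_ge0 ltW.
  by rewrite ler_piMr ?mulr_ge0 ?exprn_ge0// lerBlDr lerDl exprn_ge0.
elim: m => [|m IHm].
  by rewrite addn0 subrr rnorm0 expr0 subrr mulr0 mul0r.
rewrite -(subrK (x (k + m)%N) (x _)) -addrA (le_trans (rnormD _ _))//.
rewrite addnS (le_trans (lerD (xC _) IHm))// le_eqVlt; apply/orP; left.
by rewrite exprD exprS; apply/eqP; field; lra.
Qed.

Lemma rnorm_complete (x : nat -> A) (C q : R) : 0 <= q < 1 ->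
  (forall k, rnorm (x k.+1 - x k) <= C * q ^+ k) ->
  exists l, forall k, rnorm (l - x k) <= C * q ^+ k / (1 - q).
Proof.
move=> q01 xC; have xkm := rnorm_le_geometric q01 xC.
have q1 : 0 < 1 - q by case/andP: q01; rewrite subr_gt0.
have /cauchy_cvgP/cvg_ex[/= l xl] : cauchy (x k @[k --> \oo]).
  apply: cauchy_exP => e e0.
  have eE : e = (complex.Re e)%:C.
    by move: e0; case: e => u v; rewrite ltcE /= => /andP[/eqP ->].
  have e0' : 0 < complex.Re e by rewrite -ltcR -eE.
  have [K CK] := geometric_small (C / (1 - q)) q01 e0'.
  exists (x K), K => // k /= Kk.
  rewrite -ball_normE /ball_ /= distrC rnormE eE ltcR -(subnKC Kk).
  by rewrite (le_lt_trans (xkm _ _))// mulrAC CK.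
exists l => k; apply/ler_addgt0Pr => e e0.
have e0' : 0 < e%:C :> R[i] by rewrite ltcR.
move/cvgrPdist_lt: xl => /(_ _ e0')[K _ xK].
rewrite -(subrK (x (k + K)%N) l) -addrA (le_trans (rnormD _ _))// [leRHS]addrC.
apply: lerD; last exact: xkm.
by have := xK (k + K)%N (leq_addl _ _); rewrite /= rnormE ltcR => /ltW.
Qed.

End RealNorm.

(** * A commutative subalgebra closed under inverses *)

Section CommutativeSubalgebra.
Variables (R : realType) (A : banachAlgType R[i]) (E : set A).

Definition centralizes (z : A) : Prop := forall e, E e -> z * e = e * z.

(* The conjunct [centralizes x] makes this subalgebra commutative for every
   [E]; it contains [E] as soon as the elements of [E] commute. *)
Definition bicommutant : {pred A} :=
  [pred x | `[< centralizes x /\ forall z, centralizes z -> z * x = x * z >]].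

Lemma bicommutantP x :
  reflect (centralizes x /\ forall z, centralizes z -> z * x = x * z)
          (x \in bicommutant).
Proof. exact: asboolP. Qed.

Lemma commVr (x z : A) : z * x = x * z -> z * x^-1 = x^-1 * z.
Proof. by move=> zx; apply: (@commrV _ z x). Qed.

Lemma bicommutant_divring : divring_closed bicommutant.
Proof.
split=> [|x y /bicommutantP[xE xC] /bicommutantP[yE yC]|
          x y /bicommutantP[xE xC] /bicommutantP[yE yC]];
  apply/bicommutantP; split=> [e Ee|z zE].
- by rewrite mul1r mulr1.
- by rewrite mul1r mulr1.
- by rewrite mulrBl mulrBr xE// yE.
- by rewrite mulrBl mulrBr xC// yC.
- by rewrite -mulrA -(commVr (esym (yE _ Ee))) mulrA xE// mulrA.
- by rewrite mulrA xC// -!mulrA (commVr (yC _ zE)).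
Qed.

HB.instance Definition _ :=
  GRing.isDivringClosed.Build A bicommutant bicommutant_divring.

Lemma bicommutant_scaler : scaler_closed bicommutant.
Proof.
move=> k x /bicommutantP[xE xC]; apply/bicommutantP; split=> [e Ee|z zE].
  by rewrite -scalerAl -scalerAr xE.
by rewrite -scalerAl -scalerAr xC.
Qed.

HB.instance Definition _ :=
  GRing.isScaleClosed.Build R[i] A bicommutant bicommutant_scaler.

(** As a type, the bicommutant is a commutative unit ring, so [ring] applies. Being closed under
    inverses, it has the units of [A], hence the same spectra. *)
Record csub := CSub { csval : A; csvalP : csval \in bicommutant }.
HB.instance Definition _ := [isSub for csval].
HB.instance Definition _ := [Choice of csub by <:].
HB.instance Definition _ := [SubChoice_isSubUnitRing of csub by <:].
HB.instance Definition _ := [SubZmodule_isSubLmodule of csub by <:].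
HB.instance Definition _ := [SubNzRing_SubLmodule_isSubLalgebra of csub by <:].
HB.instance Definition _ := [SubLalgebra_isSubAlgebra of csub by <:].

Fact csub_mulC : commutative (@GRing.mul csub).
Proof.
move=> [x xE] [y yE]; apply: val_inj => /=.
by have /bicommutantP[+ _] := xE; have /bicommutantP[_ +] := yE; apply.
Qed.
HB.instance Definition _ := GRing.PzRing_hasCommutativeMul.Build csub csub_mulC.

Lemma csvalX (x : csub) n : csval (x ^+ n) = csval x ^+ n.
Proof. by elim: n => [//|n IHn]; rewrite exprS [RHS]exprS -IHn. Qed.

Definition scal (k : R[i]) : csub := k%:A.
HB.instance Definition _ := GRing.RMorphism.copy scal (in_alg csub).

End CommutativeSubalgebra.

(** * Neumann series and bounds on inverses in the subalgebra *)

Section CsubNorm.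
Variables (R : realType) (A : banachAlgType R[i]) (E : set A).
Local Notation csub := (csub E).
Implicit Types x y : csub.

Definition cnorm x : R := rnorm (csval x).

Lemma cnorm_ge0 x : 0 <= cnorm x. Proof. exact: rnorm_ge0. Qed.

Lemma cnorm0 : cnorm 0 = 0. Proof. exact: rnorm0. Qed.

Lemma cnorm_eq0 x : cnorm x = 0 -> x = 0.
Proof. by move=> /rnorm_eq0 x0; apply: val_inj. Qed.

Lemma cnorm1 : cnorm 1 = 1. Proof. exact: rnorm1. Qed.

Lemma cnormD x y : cnorm (x + y) <= cnorm x + cnorm y.
Proof. exact: rnormD. Qed.

Lemma cnormN x : cnorm (- x) = cnorm x. Proof. exact: rnormN. Qed.

Lemma cnormB x y : cnorm (x - y) <= cnorm x + cnorm y.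
Proof. by rewrite -(cnormN y) cnormD. Qed.

Lemma cnormC x y : cnorm (x - y) = cnorm (y - x).
Proof. by rewrite -cnormN opprB. Qed.

Lemma cnormM x y : cnorm (x * y) <= cnorm x * cnorm y.
Proof. exact: rnormM. Qed.

Lemma cnormMl x (r : R) : cnorm (scal E r%:C * x) = `|r| * cnorm x.
Proof. by rewrite mulr_algl; exact: rnorm_real. Qed.

Lemma csubP (x : A) (xE : forall e e', E e -> E e' -> e * e' = e' * e) :
  E x -> exists y : csub, csval y = x.
Proof.
move=> Ex; suff xS : x \in bicommutant E by exists (CSub xS).
by apply/bicommutantP; split=> [e /xE ->//|z zE]; apply: zE.
Qed.

Lemma csub_complete (x : nat -> csub) (C q : R) : 0 <= q < 1 ->
  (forall k, cnorm (x k.+1 - x k) <= C * q ^+ k) ->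
  exists l, forall k, cnorm (l - x k) <= C * q ^+ k / (1 - q).
Proof.
move=> q01 xC.
have [l lx] := @rnorm_complete _ _ (fun k => csval (x k)) C q q01 xC.
suff lS : l \in bicommutant E by exists (CSub lS).
(* Commuting with a fixed [z] passes to the limit; both conditions of the bicommutant are of this
   kind. *)
have lz z : (forall k, z * csval (x k) = csval (x k) * z) -> z * l = l * z.
  move=> zx; apply/eqP; rewrite -subr_eq0; apply/eqP/rnorm_eq0/le_anti.
  rewrite rnorm_ge0 andbT.
  apply: (@geometric_le0 _ _ (2 * (rnorm z * (C / (1 - q)))) q) => // k.
  have -> : z * l - l * z = z * (l - csval (x k)) - (l - csval (x k)) * z.
    by rewrite mulrBr mulrBl zx opprB addrA subrK.
  rewrite (le_trans (rnormD _ _))// rnormN.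
  rewrite (le_trans (lerD (rnormM _ _) (rnormM _ _)))//.
  have := ler_wpM2l (rnorm_ge0 z) (lx k); lra.
apply/bicommutantP; split=> [e Ee|z zE].
  apply/esym/lz => k; have /bicommutantP[xE _] := csvalP (x k).
  by rewrite xE.
by apply: lz => k; have /bicommutantP[_] := csvalP (x k); apply.
Qed.

(** The partial sums of the geometric series in [x] converge, and their limit is the inverse. *)
Lemma unit_sub1 x : cnorm x < 1 -> 1 - x \is a GRing.unit.
Proof.
move=> x1; have q01 : 0 <= cnorm x < 1 by rewrite cnorm_ge0.
have cX k : cnorm (x ^+ k) <= cnorm x ^+ k.
  elim: k => [|k IHk]; first by rewrite !expr0 cnorm1.
  by rewrite !exprS (le_trans (cnormM _ _))// ler_wpM2l ?cnorm_ge0.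
pose s k := \sum_(i < k) x ^+ i.
have sE k : cnorm (s k.+1 - s k) <= 1 * cnorm x ^+ k.
  by rewrite /s big_ord_recr/= [X in X - _]addrC addrK mul1r.
have [l ls] := csub_complete q01 sE.
suff l1 : (1 - x) * l = 1 by apply/unitrP; exists l; rewrite mulrC l1.
apply/eqP; rewrite -subr_eq0; apply/eqP/cnorm_eq0/le_anti.
rewrite cnorm_ge0 andbT.
apply: (@geometric_le0 _ _ (cnorm (1 - x) / (1 - cnorm x) + 1) (cnorm x)) => //.
move=> k; have -> : (1 - x) * l - 1 = (1 - x) * (l - s k) - x ^+ k.
  rewrite mulrBr -addrA -opprD; congr (_ - _).
  by rewrite -[1 - x]opprB mulNr -subrX1 opprB subrK.
rewrite (le_trans (cnormB _ _))// [leRHS]mulrDl mul1r lerD//.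
rewrite (le_trans (cnormM _ _))// -mulrA ler_wpM2l ?cnorm_ge0//.
by rewrite (le_trans (ls k))// mul1r mulrC.
Qed.

(** In [y^-1 = x^-1 - y^-1 (y - x) x^-1] the last term has at most half the norm of [y^-1] and is
    absorbed on the left. *)
Lemma cnormV_le x y (M : R) : x \is a GRing.unit -> y \is a GRing.unit ->
  cnorm x^-1 <= M -> cnorm (y - x) * M <= 2^-1 -> cnorm y^-1 <= 2 * M.
Proof.
move=> xU yU xM yxM.
have yE : y^-1 = x^-1 - y^-1 * ((y - x) * x^-1).
  by rewrite mulrBl divrr// mulrBr mulr1 mulrA mulVr// mul1r opprB addrC subrK.
have : cnorm y^-1 <= M + cnorm y^-1 * 2^-1.
  rewrite {1}yE (le_trans (cnormB _ _))// lerD// (le_trans (cnormM _ _))//.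
  rewrite ler_wpM2l ?cnorm_ge0// (le_trans (cnormM _ _))// (le_trans _ yxM)//.
  by rewrite ler_wpM2l ?cnorm_ge0.
lra.
Qed.

(* Compactness only has to propagate local bounds: a bound at [p] persists
   nearby because all the values are already known to be invertible. *)
Lemma bounded_inv (f : R * R -> csub) (K : set (R * R)) : compact K ->
  (forall p, K p -> f p \is a GRing.unit) ->
  (forall p e, 0 < e -> \forall p' \near p, cnorm (f p' - f p) < e) ->
  exists M, forall p, K p -> cnorm (f p)^-1 <= M.
Proof.
move=> cK fU fc.
have := (compact_near_coveringP _).1 cK R +oo%R
  (fun M p => K p -> cnorm (f p)^-1 <= M) _.
case=> [p Kp|M [_ /(_ (M + 1))]].
  have [M0 M1] : 0 <= cnorm (f p)^-1 /\ cnorm (f p)^-1 < cnorm (f p)^-1 + 1.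
    by rewrite cnorm_ge0 ltrDl.
  set M := cnorm (f p)^-1 + 1 in M1.
  have e0 : 0 < (2 * M)^-1 by rewrite invr_gt0; lra.
  near=> p' r.
  have Mr : 2 * M <= r by near: r; apply: nbhs_pinfty_ge; rewrite num_real.
  have : cnorm (f p' - f p) < (2 * M)^-1 by near: p'; apply: fc.
  move=> fp' Kp'; apply: le_trans Mr.
  apply: (@cnormV_le (f p) (f p') M); rewrite ?fU//; first exact: ltW.
  have -> : 2^-1 = (2 * M)^-1 * M.
    by rewrite invfM -mulrA mulVf ?mulr1//; apply/eqP; lra.
  by rewrite ler_wpM2r// ltW// (le_lt_trans M0).
rewrite ltrDl ltr01 => /(_ isT) KM.
by exists (M + 1) => p Kp; exact: (KM p Kp Kp).
Unshelve. all: by end_near.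
Qed.

End CsubNorm.

(** * Newton's iteration from [1] as a trigonometric mean *)

Section NewtonFromOne.
Variables (R : realType) (A : banachAlgType R[i]) (E : set A).
Local Notation csub := (csub E).
Local Notation scal := (@scal R A E).
Implicit Types (a x X : csub) (c t u v : R).

Lemma unit2 : (2 : csub) \is a GRing.unit.
Proof.
apply/unitrP; exists (scal 2^-1).
rewrite mulrC; split; rewrite -(rmorph_nat scal 2) -rmorphM/= mulfV ?rmorph1//.
all: by rewrite pnatr_eq0.
Qed.

Definition cnewton a X k : csub :=
  iter k (fun X => (2^-1 : R[i]) *: (X + X^-1 * a)) X.

Lemma csval_newton a X k :
  csval (cnewton a X k) = newton (csval a) (csval X) k.
Proof.
elim: k => [//|k IHk].
by rewrite /newton /= -[in RHS]/(newton _ _ k) -IHk.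
Qed.

Lemma cnewtonS a X k :
  2 * cnewton a X k.+1 = cnewton a X k + (cnewton a X k)^-1 * a.
Proof.
by rewrite /= -mulr_algl mulrA -(rmorph_nat scal 2) -rmorphM/= mulfV
  ?pnatr_eq0// rmorph1 mul1r.
Qed.

Lemma cnewton_step a X k : cnewton a X k \is a GRing.unit ->
  2 * cnewton a X k * cnewton a X k.+1 = cnewton a X k ^+ 2 + a.
Proof.
move=> XU; rewrite mulrAC cnewtonS mulrDl -expr2; congr (_ + _).
by rewrite mulrAC mulVr// mul1r.
Qed.

Lemma cos_lipschitz u v : `|cos u - cos v| <= `|u - v|.
Proof.
wlog uv : u v / u <= v.
  by case: (leP u v) => [|/ltW] uv /(_ _ _ uv)//; rewrite distrC [leRHS]distrC.
rewrite distrC [leRHS]distrC.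
have [|c _ ->] := @MVT_segment R cos (- sin) u v uv _.
  by apply: continuous_subspaceT; exact: continuous_cos.
by rewrite normrM ler_piMl//= normrN ler_norml sin_geN1 sin_le1.
Qed.

(** For [c = cos v], the two factors belong to the angles [v] and [v + pi], and the right-hand side
    to [2 v]. *)
Lemma double_angle_identity (T : comNzRingType) (a X X' c : T) :
  2 * X * X' = X ^+ 2 + a ->
  (a * (1 + c) + X ^+ 2 * (1 - c)) * (a * (1 - c) + X ^+ 2 * (1 + c)) =
  2 * X ^+ 2 * (a * (1 + (2 * c ^+ 2 - 1)) + X' ^+ 2 * (1 - (2 * c ^+ 2 - 1))).
Proof.
move=> XX'.
transitivity (4 * a * X ^+ 2 * c ^+ 2 + (X ^+ 2 + a) ^+ 2 * (1 - c ^+ 2)).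
  by ring.
by rewrite -XX'; ring.
Qed.

(** [1 / D + 1 / D' = (D + D') / (D D')]: this turns the product formula for the denominators into
    an average. *)
Lemma partial_fractions (T : comUnitRingType) (a X X' D D' D'' : T) :
  D \is a GRing.unit -> D' \is a GRing.unit -> D'' \is a GRing.unit ->
  D * D' = 2 * X ^+ 2 * D'' -> D + D' = 2 * (2 * X * X') ->
  2 * (2 * a * X' * D''^-1) = 2 * a * X * D^-1 + 2 * a * X * D'^-1.
Proof.
move=> DU D'U D''U DM DA; set I := D^-1 * D'^-1.
have -> : D^-1 = D' * I by rewrite mulrCA divrr// mulr1.
have -> : D'^-1 = D * I by rewrite mulrA divrr// mul1r.
have -> : D''^-1 = 2 * X ^+ 2 * I.
  apply: (mulIr D''U); rewrite mulVr// mulrAC -DM mulrACA divrr// mul1r.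
  by rewrite divrr.
transitivity (2 * a * X * I * (D + D')); last by ring.
by rewrite DA; ring.
Qed.

(* With [s ^+ 2 = a] and [G = ((1 - s) / (1 + s))^(2^k)], this is, up to a
   factor independent of [c], [(1 - G w) (1 - G / w)] where
   [c = (w + 1/w) / 2]; so [w -> w^2] relates level [k] to level [k.+1]. *)
Definition mean_denom a k c : csub :=
  a * (1 + scal c%:C) + cnewton a 1 k ^+ 2 * (1 - scal c%:C).

Definition segment_unit a :=
  forall t, 0 <= t <= 1 -> 1 + scal t%:C * (a - 1) \is a GRing.unit.

Lemma mean_denom0 a c :
  mean_denom a 0 c = 2 * (1 + scal ((1 + c) / 2)%:C * (a - 1)).
Proof.
have -> : c = 2 * ((1 + c) / 2) - 1 by field.
set t := (1 + c) / 2; have -> : (1 + (2 * t - 1)) / 2 = t by field.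
by rewrite /mean_denom /=; ring.
Qed.

Lemma mean_denomN1 a k : mean_denom a k (- 1) = 2 * cnewton a 1 k ^+ 2.
Proof. by rewrite /mean_denom; ring. Qed.

Lemma mean_denom1 a k : mean_denom a k 1 = 2 * a.
Proof. by rewrite /mean_denom; ring. Qed.

Lemma mean_denomM a k c : cnewton a 1 k \is a GRing.unit ->
  mean_denom a k c * mean_denom a k (- c) =
  2 * cnewton a 1 k ^+ 2 * mean_denom a k.+1 (2 * c ^+ 2 - 1).
Proof.
move=> XU.
have -> : mean_denom a k (- c) =
  a * (1 - scal c%:C) + cnewton a 1 k ^+ 2 * (1 + scal c%:C).
  by rewrite /mean_denom; ring.
rewrite /mean_denom (double_angle_identity _ (cnewton_step XU)).
have -> // : 2 * scal c%:C ^+ 2 - 1 = scal (2 * c ^+ 2 - 1)%:C.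
by ring.
Qed.

(** By the half-angle formula, the denominator at level [k.+1] is a factor of a product of two at
    level [k]. The case [c = -1] gives the invertibility of the iterate along the way. *)
Lemma mean_denom_unit a k c : segment_unit a -> -1 <= c <= 1 ->
  mean_denom a k c \is a GRing.unit.
Proof.
move=> aU; elim: k c => [|k IHk] c c1.
  by rewrite mean_denom0 unitrM unit2 aU//; lra.
have XU : cnewton a 1 k \is a GRing.unit.
  have : mean_denom a k (- 1) \is a GRing.unit by apply: IHk; lra.
  by rewrite mean_denomN1 unitrM unit2 unitrX_pos.
have := mean_denomM (Num.sqrt ((1 + c) / 2)) XU.
rewrite sqr_sqrtr; last by lra.
have -> : 2 * ((1 + c) / 2) - 1 = c by field.
have s0 := sqrtr_ge0 ((1 + c) / 2).
have s1 : Num.sqrt ((1 + c) / 2) <= 1.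
  by rewrite -[leRHS](@sqrtr1 R) ler_wsqrtr//; lra.
move=> /(congr1 (fun x => x \is a GRing.unit)).
by rewrite !unitrM !IHk /=; [case/esym/andP | lra | lra].
Qed.

Lemma cnewton1_unit a k : segment_unit a -> cnewton a 1 k \is a GRing.unit.
Proof.
move=> aU; have : mean_denom a k (- 1) \is a GRing.unit.
  by apply: mean_denom_unit => //; lra.
by rewrite mean_denomN1 unitrM unit2 unitrX_pos.
Qed.

Lemma segment_unit1 a : segment_unit a -> a \is a GRing.unit.
Proof.
move=> /(_ 1); rewrite ler01 lexx => /(_ isT).
by rewrite rmorph1 mul1r addrC subrK.
Qed.

(* The mean of [a (1 + (1 + cos v) / 2 (a - 1))^-1] over the [2^k] angles [v]
   with [2^k v = u] modulo [2 pi]. *)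
Definition newton_mean a k u : csub :=
  2 * a * cnewton a 1 k * (mean_denom a k (cos u))^-1.

Lemma cos_bound u : -1 <= cos u <= 1.
Proof. by rewrite cos_geN1 cos_le1. Qed.

Lemma newton_mean0 a k : segment_unit a -> newton_mean a k 0 = cnewton a 1 k.
Proof.
move=> aU; rewrite /newton_mean cos0 mean_denom1 mulrAC divrr ?mul1r//.
by rewrite unitrM unit2 segment_unit1.
Qed.

(** The iterate is the mean at angle [0], so twice the Newton step is the difference of the means at
    [pi] and [0]. *)
Lemma newton_mean_pi a k : segment_unit a ->
  newton_mean a k pi = (cnewton a 1 k)^-1 * a.
Proof.
move=> aU; have XU := cnewton1_unit k aU.
rewrite /newton_mean cospi mean_denomN1; apply: (canLR (mulrK _)).
  by rewrite unitrM unit2 unitrX.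
transitivity (2 * a * cnewton a 1 k * ((cnewton a 1 k)^-1 * cnewton a 1 k)).
  by rewrite mulVr// mulr1.
by ring.
Qed.

(** The angles [v] with [2^(k+1) v = u] are those with [2^k v = u / 2] and those with
    [2^k v = u / 2 + pi]. *)
Lemma newton_meanS a k u : segment_unit a ->
  2 * newton_mean a k.+1 u =
  newton_mean a k (u / 2) + newton_mean a k (u / 2 + pi).
Proof.
move=> aU; have XU := cnewton1_unit k aU.
have uE : cos u = 2 * cos (u / 2) ^+ 2 - 1.
  have -> : cos u = cos ((u / 2) *+ 2) by rewrite -mulr_natr divfK ?pnatr_eq0.
  by rewrite cos_mulr2n mulr_natl.
rewrite /newton_mean uE cosDpi.
have D1 : mean_denom a k (cos (u / 2)) \is a GRing.unit.
  by rewrite mean_denom_unit ?cos_bound.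
have D2 : mean_denom a k (- cos (u / 2)) \is a GRing.unit.
  by rewrite mean_denom_unit// -cosDpi cos_bound.
have D3 : mean_denom a k.+1 (2 * cos (u / 2) ^+ 2 - 1) \is a GRing.unit.
  by rewrite mean_denom_unit// -uE cos_bound.
have D12 := mean_denomM (cos (u / 2)) XU.
have DD : mean_denom a k (cos (u / 2)) + mean_denom a k (- cos (u / 2)) =
    2 * (2 * cnewton a 1 k * cnewton a 1 k.+1).
  by rewrite cnewton_step// /mean_denom; ring.
exact: (partial_fractions a D1 D2 D3 D12 DD).
Qed.

End NewtonFromOne.

(** * Convergence and stability of the iteration from [1] *)

Section NewtonFromOneLimit.
Variables (R : realType) (A : banachAlgType R[i]) (E : set A).
Local Notation csub := (csub E).
Local Notation scal := (@scal R A E).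
Implicit Types (a b x y X : csub) (c t u v M : R).

Lemma cnorm2 x : cnorm (2 * x) = 2 * cnorm x.
Proof.
have -> : (2 : csub) = scal 2%:C by rewrite !rmorph_nat.
by rewrite cnormMl ger0_norm.
Qed.

Definition segment_bound a M :=
  forall t, 0 <= t <= 1 -> cnorm (1 + scal t%:C * (a - 1))^-1 <= M.

Lemma segment_bound_ge0 a M : segment_bound a M -> 0 <= M.
Proof.
by move=> /(_ 0); rewrite lexx ler01 => /(_ isT); apply/le_trans/cnorm_ge0.
Qed.

Lemma cos_half u : 0 <= (1 + cos u) / 2 <= 1.
Proof. by have := cos_bound u; clear; lra. Qed.

Lemma newton_mean_init a u : segment_unit a ->
  newton_mean a 0 u = a * (1 + scal ((1 + cos u) / 2)%:C * (a - 1))^-1.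
Proof.
move=> /(_ _ (cos_half u)) DU.
rewrite /newton_mean mean_denom0 mulr1 invrM ?unit2// (mulrC 2) -mulrA.
congr (_ * _).
by rewrite mulrCA mulrV ?unit2// mulr1.
Qed.

Lemma cnorm_subV x y M : x \is a GRing.unit -> y \is a GRing.unit ->
  cnorm x^-1 <= M -> cnorm y^-1 <= M ->
  cnorm (x^-1 - y^-1) <= M * M * cnorm (y - x).
Proof.
move=> xU yU xM yM.
have -> : x^-1 - y^-1 = x^-1 * y^-1 * (y - x).
  by rewrite mulrBr divrK// mulrAC mulVr// mul1r.
rewrite (le_trans (cnormM _ _))// ler_wpM2r ?cnorm_ge0//.
by rewrite (le_trans (cnormM _ _))// ler_pM ?cnorm_ge0.
Qed.

(** At level [0] this follows from the Lipschitz bounds on cosine and inversion. Each averaging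
    halves the angles, hence the constant. *)
Lemma newton_mean_lipschitz a M : segment_unit a -> segment_bound a M ->
  forall k u v, cnorm (newton_mean a k u - newton_mean a k v) <=
    cnorm a * (M * M * cnorm (a - 1)) * 2^-1 ^+ k * `|u - v|.
Proof.
move=> aU aM; set L := cnorm a * _.
have L0 : 0 <= L by rewrite !mulr_ge0 ?cnorm_ge0 ?(segment_bound_ge0 aM).
elim=> [|k IHk] u v.
  rewrite !newton_mean_init// -mulrBr (le_trans (cnormM _ _))// expr0 mulr1.
  rewrite /L -[leRHS]mulrA ler_wpM2l ?cnorm_ge0//.
  rewrite (le_trans (cnorm_subV _ _ (aM _ _) (aM _ _)))// ?aU ?cos_half//.
  rewrite -[leRHS]mulrA ler_wpM2l ?mulr_ge0 ?(segment_bound_ge0 aM)//.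
  set s := (1 + cos v) / 2; set t := (1 + cos u) / 2.
  have -> : 1 + scal s%:C * (a - 1) - (1 + scal t%:C * (a - 1)) =
    scal (s - t)%:C * (a - 1) by ring.
  rewrite cnormMl mulrC ler_wpM2l ?cnorm_ge0//.
  have -> : s - t = (cos v - cos u) / 2 by rewrite /s /t; field.
  rewrite normrM distrC (ger0_norm (_ : 0 <= 2^-1)) ?invr_ge0//.
  have := cos_lipschitz u v; have := normr_ge0 (cos u - cos v); clear; lra.
rewrite -(ler_pM2l (_ : 0 < 2))// -cnorm2 mulrBr !newton_meanS//.
rewrite opprD addrACA (le_trans (cnormD _ _))//.
apply: le_trans (lerD (IHk _ _) (IHk _ _)) _.
have -> : u / 2 + pi - (v / 2 + pi) = (u - v) / 2 by ring.
have -> : u / 2 - v / 2 = (u - v) / 2 by ring.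
rewrite normrM (ger0_norm (_ : 0 <= 2^-1)) ?invr_ge0//.
by rewrite exprS le_eqVlt; apply/orP; left; apply/eqP; field.
Qed.

Lemma half01 : 0 <= (2^-1 : R) < 1. Proof. lra. Qed.

Lemma cnewton1_limit a M : segment_unit a -> segment_bound a M ->
  exists y, y ^+ 2 = a /\
    exists C, forall k, cnorm (y - cnewton a 1 k) <= C * 2^-1 ^+ k.
Proof.
move=> aU aM; set X := cnewton a 1.
have XU k : X k \is a GRing.unit by exact: cnewton1_unit.
set L := cnorm a * (M * M * cnorm (a - 1)).
have [k|y yX] := @csub_complete _ _ _ X (L * pi / 2) _ half01.
  rewrite -(ler_pM2l (_ : 0 < 2))// -cnorm2.
  have -> : 2 * (X k.+1 - X k) = newton_mean a k pi - newton_mean a k 0.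
    by rewrite newton_mean_pi// newton_mean0// mulrBr cnewtonS -/X; ring.
  apply: le_trans (newton_mean_lipschitz aU aM _ _ _) _.
  rewrite subr0 ger0_norm ?pi_ge0// -/L.
  by rewrite le_eqVlt; apply/orP; left; apply/eqP; field.
set C := L * pi / 2 / (1 - 2^-1).
have {}yX k : cnorm (y - X k) <= C * 2^-1 ^+ k by rewrite /C mulrAC.
exists y; split; last by exists C.
have C0 : 0 <= C.
  by have := le_trans (cnorm_ge0 _) (yX 0%N); rewrite expr0 mulr1.
apply/eqP; rewrite -subr_eq0; apply/eqP/cnorm_eq0/le_anti.
rewrite cnorm_ge0 andbT.
apply: (@geometric_le0 _ _ (C * C + 2 * (cnorm y + C) * C) _ half01) => k.
have q1 n : 0 <= (2^-1 : R) ^+ n <= 1.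
  by rewrite exprn_ge0 ?exprn_ile1 ?invr_ge0 ?invf_le1 ?ler1n.
have yXC n : cnorm (y - X n) <= C.
  by rewrite (le_trans (yX n))// ler_piMr//; case/andP: (q1 n).
(* Substituting the Newton relation for [a] leaves only terms containing an error [y - X n]. *)
have -> : y ^+ 2 - a = (y - X k) * (y - X k) + 2 * (X k * (y - X k.+1)).
  have -> : a = 2 * X k * X k.+1 - X k ^+ 2.
    by rewrite cnewton_step// addrC addKr.
  by ring.
rewrite (le_trans (cnormD _ _))// cnorm2 [leRHS]mulrDl; apply: lerD.
  rewrite (le_trans (cnormM _ _))// -[leRHS]mulrA.
  by rewrite ler_pM ?cnorm_ge0.
rewrite -[leRHS]mulrA -[leRHS]mulrA; apply: ler_wpM2l => //.
rewrite (le_trans (cnormM _ _))//; apply: ler_pM; rewrite ?cnorm_ge0//.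
  rewrite -(subrK y (X k)) addrC (le_trans (cnormD _ _))// lerD// cnormC.
  exact: yXC.
rewrite (le_trans (yX _))// ler_wpM2l// exprS ler_piMl ?exprn_ge0 ?invr_ge0//.
by rewrite invf_le1 ?ler1n.
Qed.

(** The bound holds between the means at level [0], and averaging preserves it; so it is uniform in
    [k]. *)
Lemma cnewton1_diff a b M : segment_unit a -> segment_bound a M ->
  segment_unit b -> segment_bound b M -> forall k,
  cnorm (cnewton a 1 k - cnewton b 1 k) <=
    (M + cnorm b * (M * M)) * cnorm (a - b).
Proof.
move=> aU aM bU bM k; rewrite -(newton_mean0 _ aU) -(newton_mean0 _ bU).
(* The angle [0] is generalised because the recursion on the means changes the angle. *)
move: k 0; elim=> [|k IHk] u.
  rewrite !newton_mean_init//; set t := (1 + cos u) / 2.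
  have /andP[t0 t1] : 0 <= t <= 1 by exact: cos_half.
  have [tU tU'] := (aU t, bU t); have [tM tM'] := (aM t, bM t).
  rewrite !(t0, t1) in tU tU' tM tM'.
  set V := (1 + scal t%:C * (a - 1))^-1 in tM *.
  set W := (1 + scal t%:C * (b - 1))^-1 in tM' *.
  have -> : a * V - b * W = (a - b) * V + b * (V - W) by ring.
  rewrite (le_trans (cnormD _ _))// [leRHS]mulrDl; apply: lerD.
    by rewrite mulrC (le_trans (cnormM _ _))// ler_wpM2r ?cnorm_ge0// tM.
  rewrite (le_trans (cnormM _ _))// -[leRHS]mulrA ler_wpM2l ?cnorm_ge0//.
  apply: le_trans (cnorm_subV (tU isT) (tU' isT) (tM isT) (tM' isT)) _.
  rewrite ler_wpM2l ?mulr_ge0 ?(segment_bound_ge0 aM)//.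
  have -> : 1 + scal t%:C * (b - 1) - (1 + scal t%:C * (a - 1)) =
    scal t%:C * (b - a) by ring.
  by rewrite cnormMl ger0_norm// cnormC ler_piMl ?cnorm_ge0.
rewrite -(ler_pM2l (_ : 0 < 2))// -cnorm2 mulrBr !newton_meanS//.
rewrite opprD addrACA (le_trans (cnormD _ _))//.
by rewrite [leRHS]mulr_natl mulr2n lerD.
Qed.

End NewtonFromOneLimit.

(** * Scaling of the iteration, and spectra in half-planes *)

Section PrincipalRoot.
Variables (R : realType) (A : banachAlgType R[i]) (E : set A).
Local Notation csub := (csub E).
Local Notation scal := (@scal R A E).
Implicit Types (a b s x y X : csub) (t M : R) (l z : R[i]).

(** With [a = 1], this reduces the iteration for a square to the sign iteration
    [Y -> (Y + Y^-1) / 2]. *)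
Lemma cnewton_scale a s X k : s \is a GRing.unit ->
  (forall j, cnewton a X j \is a GRing.unit) ->
  cnewton (s ^+ 2 * a) (s * X) k = s * cnewton a X k.
Proof.
move=> sU XU; elim: k => [//|k IHk].
rewrite -[LHS]/(2^-1 *: (cnewton (s ^+ 2 * a) (s * X) k +
  (cnewton (s ^+ 2 * a) (s * X) k)^-1 * (s ^+ 2 * a))) IHk.
rewrite [in RHS]/= -scalerAr mulrDr; congr (_ *: (_ + _)).
set Y := cnewton a X k; rewrite invrM//; last exact: XU.
have -> : Y^-1 / s * (s ^+ 2 * a) = s * (Y^-1 * a) * (s^-1 * s) by ring.
by rewrite mulVr// mulr1.
Qed.

(* The sign iteration does not distinguish [x] from [x^-1] after one step. *)
Lemma cnewton_sign x k : x \is a GRing.unit ->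
  (forall j, cnewton (x ^+ 2) 1 j \is a GRing.unit) ->
  cnewton 1 x k.+1 = x^-1 * cnewton (x ^+ 2) 1 k.+1.
Proof.
move=> xU XU; have -> : cnewton 1 x k.+1 = cnewton 1 x^-1 k.+1.
  by rewrite /cnewton !iterSr mulr1 mulr1 invrK addrC.
have := cnewton_scale k.+1 (_ : x^-1 \is a GRing.unit) XU.
by rewrite unitrV mulr1 -exprMn mulVr// expr1n; apply.
Qed.

Lemma scal_unit l : l != 0 -> scal l \is a GRing.unit.
Proof. by move=> l0; apply: rmorph_unit; rewrite unitfE. Qed.

Lemma Re_inv_le0 l : complex.Re l <= 0 -> complex.Re l^-1 <= 0.
Proof.
case: l => u v /= u0; rewrite mulr_le0_ge0// invr_ge0.
by rewrite addr_ge0 ?sqr_ge0.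
Qed.

(* A point [l] of the spectrum of [y] with nonpositive real part would, under
   the scalar iteration, stay in the closed left half-plane and in the spectra
   of the iterates of [y]. *)
Lemma half_plane_newton y k : (forall j, cnewton 1 y j \is a GRing.unit) ->
  cnorm (1 - cnewton 1 y k) < 1 ->
  spectrum (csval y) `<=` @right_half_plane R.
Proof.
move=> yU yk l yl; rewrite /right_half_plane /= ltNge; apply/negP => l0.
have [l' [l'0 /negP]] : exists l', complex.Re l' <= 0 /\
    cnewton 1 y k - scal l' \isn't a GRing.unit.
  elim: k {yk} => [|k [m [m0 ym]]]; first by exists l.
  exists (2^-1 * (m + m^-1)); split.
    rewrite -[2^-1](_ : (2^-1)%:C = _); last by rewrite fmorphV rmorph_nat.
    have := Re_inv_le0 m0; case: (m^-1) => u v /=; case: m {ym} m0 => u' v' /=.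
    by lra.
  have mN0 : m != 0.
    by apply: contra ym => /eqP ->; rewrite rmorph0 subr0.
  apply: contra ym => ym; set Y := cnewton 1 y k in ym *.
  (* The product is twice the difference of the next iterates of [Y] and [m], so invertibility of
     that difference forces invertibility of [Y - m]. *)
  suff : (Y - scal m) * (1 - Y^-1 * scal m^-1) \is a GRing.unit.
    by rewrite unitrM => /andP[].
  have -> : (Y - scal m) * (1 - Y^-1 * scal m^-1) =
      2 * (cnewton 1 y k.+1 - scal (2^-1 * (m + m^-1))).
    rewrite [RHS]mulrBr cnewtonS -/Y mulr1 -(rmorph_nat scal 2) -rmorphM/=.
    rewrite mulVKf// rmorphD/=.
    transitivity (Y - Y / Y * scal m^-1 - scal m + Y^-1 * (scal m * scal m^-1)).
      by ring.
    by rewrite divrr ?yU// -rmorphM/= divff// rmorph1; ring.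
  by rewrite unitrM unit2.
apply.
set Y := cnewton 1 y k in yk *.
(* Hence [|1 - l'| >= 1], and dividing [Y - l'] by [1 - l'] leaves a perturbation of [1] of norm
   less than [1]. *)
have l1 : 1 <= complex.Re (1 - l') by move: l'0; case: (l') => u v /=; lra.
have lN0 : 1 - l' != 0 by apply/eqP => l'1; move: l1; rewrite l'1 /= ler10.
have -> : Y - scal l' = scal (1 - l') * (1 - scal (1 - l')^-1 * (1 - Y)).
  rewrite mulrBr mulrA -rmorphM/= mulfV// rmorph1; ring.
rewrite unitrM scal_unit//= unit_sub1// (le_lt_trans _ yk)//.
have -> : scal (1 - l')^-1 * (1 - Y) = (1 - l')^-1 *: (1 - Y).
  by rewrite mulr_algl.
rewrite /cnorm [leLHS]rnormZ ler_piMl ?cnorm_ge0// .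
have [r rE] : exists r : R, `|1 - l'| = r%:C.
  by exists (complex.Re `|1 - l'|); rewrite normc_def.
have r1 : 1 <= r.
  have := normc_ge_Re (1 - l'); rewrite rE lecR; apply: le_trans.
  exact: le_trans l1 (ler_norm _).
by rewrite normfV rE -fmorphV/= invf_le1// (lt_le_trans ltr01).
Qed.

(** For [t > 0] the element is [t (a + (1 - t) / t)], and [(1 - t) / t] is nonnegative. *)
Lemma nonpos_segment_unit a :
  spectrum (csval a) `&` @nonpos_reals R = set0 -> segment_unit a.
Proof.
move=> spa t /andP[t0 t1]; have [->|tN0] := eqVneq t 0.
  by rewrite rmorph0 mul0r addr0 unitr1.
have tC0 : t%:C != 0 :> R[i] by rewrite fmorph_eq0.
have -> : 1 + scal t%:C * (a - 1) =
    scal t%:C * (a - scal (- ((1 - t) / t))%:C).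
  transitivity (scal t%:C * a + scal (t * ((1 - t) / t))%:C); last by ring.
  by rewrite mulrCA divff// mulr1; ring.
rewrite unitrM scal_unit//=; apply: contrapT => /negP aN.
suff : (spectrum (csval a) `&` @nonpos_reals R) (- ((1 - t) / t))%:C.
  by rewrite spa.
split; first exact: aN.
exists (- ((1 - t) / t)) => //=.
by rewrite oppr_le0 divr_ge0// subr_ge0.
Qed.

(** For [t > 0], [- z / t] is outside the open right half-plane. For [t = 0] only the nonzero scalar
    [z] remains. *)
Lemma half_plane_unit x t z : spectrum (csval x) `<=` @right_half_plane R ->
  0 <= t -> 0 <= complex.Re z -> (t%:C + z != 0) ->
  scal t%:C * x + scal z \is a GRing.unit.
Proof.
move=> spx t0 z0; have [->|tN0] := eqVneq t 0.
  by rewrite !rmorph0 mul0r !add0r; exact: scal_unit.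
have tC0 : t%:C != 0 :> R[i] by rewrite fmorph_eq0.
move=> _; have -> : scal t%:C * x + scal z =
    scal t%:C * (x - scal (- (t^-1%:C * z))).
  transitivity (scal t%:C * x + scal (t%:C * t^-1%:C * z)); last by ring.
  by rewrite -rmorphM/= divff// mul1r.
rewrite unitrM scal_unit//=; apply: contrapT => /negP /spx.
rewrite /right_half_plane /= ltNge; apply/negP.
rewrite negbK.
case: z z0 => u v /= u0; rewrite mul0r subr0 oppr_le0 mulr_ge0// invr_ge0//.
Qed.

(* [(1 - y / x) / 2] is an idempotent of norm less than [1], hence zero. *)
Lemma root_close x y : x \is a GRing.unit -> y ^+ 2 = x ^+ 2 ->
  cnorm (1 - y * x^-1) < 2 -> y = x.
Proof.
move=> xU yx; set s := y * x^-1; set h := scal (2^-1)%:C => s1.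
have hh : h + h = 1.
  by rewrite -!rmorphD/= (_ : 2^-1 + 2^-1 = 1) ?rmorph1//; field.
have s2 : s ^+ 2 = 1 by rewrite exprMn yx -exprMn divrr// expr1n.
have p2 : h * (1 - s) * (h * (1 - s)) = h * (1 - s).
  transitivity (h * (h + h) * (1 - s) + h * h * (s ^+ 2 - 1)); first by ring.
  by rewrite hh s2 subrr mulr0 addr0 mulr1.
have p1 : cnorm (h * (1 - s)) < 1.
  by rewrite cnormMl ger0_norm ?invr_ge0//; move: s1; lra.
suff p0 : h * (1 - s) = 0.
  have : (h + h) * (1 - s) = 0 by rewrite mulrDl p0 addr0.
  rewrite hh mul1r => /eqP; rewrite subr_eq0 => /eqP s1'.
  by rewrite -[y](divrK xU) -/s -s1' mul1r.
apply: cnorm_eq0; apply/le_anti; rewrite cnorm_ge0 andbT leNgt.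
apply/negP => p0.
by have := cnormM (h * (1 - s)) (h * (1 - s)); rewrite p2 leNgt gtr_pMl// p1.
Qed.

Definition csegment x t : csub := 1 + scal t%:C * (x - 1).

(** For [t' > 0], with [w = csegment x t] and [r^2 = (1 - t') / t'], the element is
    [t' (w + i r) (w - i r)], a product of units by [half_plane_unit]. *)
Lemma csegment_unit x t t' : spectrum (csval x) `<=` @right_half_plane R ->
  0 <= t <= 1 -> 0 <= t' <= 1 ->
  1 + scal t'%:C * (csegment x t ^+ 2 - 1) \is a GRing.unit.
Proof.
move=> spx /andP[t0 t1] /andP[t'0 t'1].
have [->|t'N0] := eqVneq t' 0; first by rewrite !rmorph0 mul0r addr0 unitr1.
have t'C0 : t'%:C != 0 :> R[i] by rewrite fmorph_eq0.
set r := Num.sqrt ((1 - t') / t').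
have r2 : t' * r ^+ 2 = 1 - t'.
  rewrite sqr_sqrtr ?divr_ge0 ?subr_ge0// mulrC divfK//.
have u1 (e : R[i]) : complex.Re e = 0 ->
    scal t%:C * x + scal ((1 - t)%:C + e) \is a GRing.unit.
  move=> e0; apply: half_plane_unit => //.
    by case: e e0 => u v /= ->; rewrite addr0 subr_ge0.
  case: e e0 => u v /= ->; rewrite -complexr0.
  by apply/eqP => -[] /=; lra.
pose e : R[i] := 0 +i* r.
have e2 : e * e = - (r ^+ 2)%:C.
  by rewrite /e; simpc; rewrite expr2.
have -> : 1 + scal t'%:C * (csegment x t ^+ 2 - 1) = scal t'%:C *
    ((scal t%:C * x + scal ((1 - t)%:C + e)) *
     (scal t%:C * x + scal ((1 - t)%:C + - e))).
  transitivity (scal (t' * r ^+ 2)%:C + scal t'%:C * csegment x t ^+ 2).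
    by rewrite r2; ring.
  transitivity (scal t'%:C * (csegment x t ^+ 2 - scal (e * e))).
    by rewrite e2; ring.
  by rewrite /csegment; ring.
rewrite !unitrM scal_unit//= !u1//= ?oppr0//.
Qed.

End PrincipalRoot.

(** * Uniform bounds on inverses by compactness *)

Section RootExistence.
Variables (R : realType) (A : banachAlgType R[i]) (E : set A).
Local Notation csub := (csub E).
Local Notation scal := (@scal R A E).
Implicit Types (a b s x y X : csub) (t M : R) (l z : R[i]).

Lemma near_scal_lin (al be : R * R -> R) x y p (e : R) :
  continuous al -> continuous be -> 0 < e -> \forall p' \near p,
  cnorm (1 + scal (al p')%:C * x + scal (be p')%:C * y -
         (1 + scal (al p)%:C * x + scal (be p)%:C * y)) < e.
Proof.
move=> cal cbe e0; set N := cnorm x + cnorm y + 1.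
have [x0 y0] := (cnorm_ge0 x, cnorm_ge0 y).
have N0 : 0 < N by rewrite /N; lra.
have d0 : 0 < e / N by rewrite divr_gt0.
near=> p'.
have al' : `|al p - al p'| < e / N.
  by near: p'; move/cvgrPdist_lt: (cal p); apply.
have be' : `|be p - be p'| < e / N.
  by near: p'; move/cvgrPdist_lt: (cbe p); apply.
set al1 := al p'; set be1 := be p'; set al0 := al p; set be0 := be p.
have -> : 1 + scal al1%:C * x + scal be1%:C * y -
          (1 + scal al0%:C * x + scal be0%:C * y) =
          scal (al1 - al0)%:C * x + scal (be1 - be0)%:C * y by ring.
rewrite (le_lt_trans (cnormD _ _))// !cnormMl distrC (distrC be1).
have -> : e = e / N * (cnorm x + cnorm y + 1) by rewrite divfK// gt_eqF.
rewrite [ltRHS]mulrDr mulr1 mulrDr -[ltLHS]addr0 ler_ltD// lerD//.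
  by rewrite ler_wpM2r// ltW.
by rewrite ler_wpM2r// ltW.
Unshelve. all: by end_near.
Qed.

Lemma square_compact : compact (`[0, 1] `*` `[0, 1] : set (R * R)).
Proof. by apply: compact_setX; exact: segment_compact. Qed.

(** This form covers both the segment from [1] to [a] and, for all [t] at once, those from [1] to
    [csegment x t ^+ 2]. *)
Lemma square_bounded (al be : R * R -> R) x y :
  continuous al -> continuous be ->
  (forall t u, 0 <= t <= 1 -> 0 <= u <= 1 ->
    1 + scal (al (t, u))%:C * x + scal (be (t, u))%:C * y \is a GRing.unit) ->
  exists M, forall t u, 0 <= t <= 1 -> 0 <= u <= 1 ->
    cnorm (1 + scal (al (t, u))%:C * x + scal (be (t, u))%:C * y)^-1 <= M.
Proof.
move=> cal cbe fU.
have [|p e e0|M KM] := @bounded_inv R A E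
  (fun p => 1 + scal (al p)%:C * x + scal (be p)%:C * y) _ square_compact.
- by case=> t u [/=]; rewrite !in_itv /=; exact: fU.
- exact: near_scal_lin.
by exists M => t u t01 u01; apply: (KM (t, u)); rewrite /= !in_itv.
Qed.

Lemma segment_bounded a : segment_unit a -> exists M, segment_bound a M.
Proof.
move=> aU; have [||t u t01 _|M aM] := @square_bounded fst (fun=> 0) (a - 1) 0.
- by move=> ?; exact: cvg_fst.
- by move=> ?; exact: cvg_cst.
- by rewrite mulr0 addr0; exact: aU.
by exists M => t t01; have := aM t 0 t01; rewrite mulr0 addr0 lexx ler01; apply.
Qed.

Lemma csegment_bounded x : spectrum (csval x) `<=` @right_half_plane R ->
  exists M, forall t, 0 <= t <= 1 -> segment_bound (csegment x t ^+ 2) M.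
Proof.
move=> spx.
have fE t u : 1 + scal u%:C * (csegment x t ^+ 2 - 1) =
    1 + scal (2 * t * u)%:C * (x - 1) + scal (t * t * u)%:C * (x - 1) ^+ 2.
  by rewrite /csegment; ring.
have [||t u t01 u01|M xM] := @square_bounded (fun p => 2 * p.1 * p.2)
  (fun p => p.1 * p.1 * p.2) (x - 1) ((x - 1) ^+ 2).
- move=> p; apply: cvgM; last exact: cvg_snd.
  by apply: cvgM; [exact: cvg_cst | exact: cvg_fst].
- move=> p; apply: cvgM; last exact: cvg_snd.
  by apply: cvgM; exact: cvg_fst.
- by rewrite -fE; exact: csegment_unit.
by exists M => t t01 u u01; rewrite fE; exact: xM.
Qed.

End RootExistence.

(** * Continuation, and existence of the principal root *)

Section PrincipalRootLimit.
Variables (R : realType) (A : banachAlgType R[i]) (E : set A).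
Local Notation csub := (csub E).
Local Notation scal := (@scal R A E).
Implicit Types (a b x y z : csub) (t M : R).

Definition cnewton1_to a y :=
  exists C, forall k, cnorm (y - cnewton a 1 k) <= C * 2^-1 ^+ k.

Lemma cnewton11 k : cnewton 1 1 k = 1 :> csub.
Proof.
elim: k => [//|k IHk]; apply: (mulrI (@unit2 R A E)).
by rewrite cnewtonS IHk invr1 !mulr1.
Qed.

Lemma cnewton1_to_uniq_diff a b y z (d : R) : cnewton1_to a y ->
  cnewton1_to b z -> (forall k, cnorm (cnewton a 1 k - cnewton b 1 k) <= d) ->
  cnorm (y - z) <= d.
Proof.
move=> [C yC] [D zD] ab; rewrite -subr_le0.
apply: (@geometric_le0 _ _ (C + D) _ (half01 R)) => k.
rewrite lerBlDr.
have -> : y - z = (y - cnewton a 1 k) - (z - cnewton b 1 k) +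
  (cnewton a 1 k - cnewton b 1 k) by ring.
rewrite (le_trans (cnormD _ _))// lerD// (le_trans (cnormB _ _))//.
by rewrite mulrDl lerD.
Qed.

Lemma csegment_sub x t t' :
  csegment x t - csegment x t' = scal (t - t')%:C * (x - 1).
Proof. by rewrite /csegment; ring. Qed.

Lemma cnorm_csegment x t : 0 <= t <= 1 ->
  cnorm (csegment x t) <= 1 + cnorm (x - 1).
Proof.
move=> /andP[t0 t1]; rewrite (le_trans (cnormD _ _))// cnorm1 lerD2l.
by rewrite cnormMl ger0_norm// ler_piMl ?cnorm_ge0.
Qed.

(* Continuation along [1 + t (x - 1)]: the limit for its square is a square
   root which depends uniformly continuously on [t], so it cannot leave
   [1 + t (x - 1)] itself. *)
Lemma cnewton1_half_plane x : spectrum (csval x) `<=` @right_half_plane R ->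
  cnewton1_to (x ^+ 2) x.
Proof.
move=> spx; have [M0 xM0] := csegment_bounded spx.
set xs := csegment x in xM0 *.
have xU t : 0 <= t <= 1 -> segment_unit (xs t ^+ 2).
  by move=> t01 u u01; exact: csegment_unit.
have M0_ge0 : 0 <= M0.
  apply: (@segment_bound_ge0 _ _ _ (xs 0 ^+ 2)).
  by apply: xM0; rewrite lexx ler01.
have [B BE] : exists B, B = 1 + cnorm (x - 1) by eexists.
have B0 : 0 <= B by rewrite BE addr_ge0 ?cnorm_ge0.
(* [K] bounds [1 - y / xs t'] per unit of [|t - t'|]: the first factor bounds [xs t' - y] by way of
   [xs t], and [B * M0] bounds the inverse of [xs t']. The threshold [2] below is that of
   [root_close]. *)
set K := ((M0 + B ^+ 2 * (M0 * M0)) * (2 * B * B) + B) * (B * M0).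
have K0 : 0 <= K.
  by do 9?[apply: mulr_ge0 | apply: addr_ge0 | apply: exprn_ge0].
have step t t' : 0 <= t <= 1 -> 0 <= t' <= 1 -> K * `|t - t'| < 2 ->
    cnewton1_to (xs t ^+ 2) (xs t) -> cnewton1_to (xs t' ^+ 2) (xs t').
  move=> t01 t'01 Kt tlim.
  have [y [yy ylim]] := cnewton1_limit (xU _ t'01) (xM0 _ t'01).
  suff yE : y = xs t' by rewrite yE in ylim.
  have x2U := segment_unit1 (xU _ t'01).
  have xtU : xs t' \is a GRing.unit by rewrite unitrX_pos in x2U.
  apply: root_close => //; apply: le_lt_trans Kt.
  have Bx u : 0 <= u <= 1 -> cnorm (xs u) <= B.
    by rewrite BE; exact: cnorm_csegment.
  have xB : cnorm (xs t - xs t') <= `|t - t'| * B.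
    by rewrite csegment_sub cnormMl BE ler_wpM2l// lerDr ler01.
  have x2B : cnorm (xs t ^+ 2 - xs t' ^+ 2) <= `|t - t'| * (2 * B * B).
    have -> : xs t ^+ 2 - xs t' ^+ 2 = (xs t - xs t') * (xs t + xs t') by ring.
    apply: le_trans (cnormM _ _) _.
    have -> : `|t - t'| * (2 * B * B) = `|t - t'| * B * (B + B) by ring.
    by rewrite ler_pM ?cnorm_ge0 ?xB// (le_trans (cnormD _ _))// lerD ?Bx.
  have tyB : cnorm (xs t - y) <=
      (M0 + B ^+ 2 * (M0 * M0)) * (`|t - t'| * (2 * B * B)).
    apply: (cnewton1_to_uniq_diff tlim ylim) => k.
    apply: le_trans
      (cnewton1_diff (xU _ t01) (xM0 _ t01) (xU _ t'01) (xM0 _ t'01) k) _.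
    rewrite ler_pM ?x2B ?cnorm_ge0 ?addr_ge0 ?mulr_ge0 ?cnorm_ge0// lerD2l.
    rewrite ler_wpM2r ?mulr_ge0// (le_trans (cnormM _ _))//.
    by rewrite expr2 ler_pM ?cnorm_ge0 ?Bx.
  have xVB : cnorm (xs t')^-1 <= B * M0.
    have -> : (xs t')^-1 = xs t' * (xs t' ^+ 2)^-1.
      by rewrite -exprVn [in RHS]expr2 mulrA divrr// mul1r.
    apply: le_trans (cnormM _ _) _; rewrite ler_pM ?cnorm_ge0 ?Bx//.
    have := xM0 _ t'01 1; rewrite ler01 lexx => /(_ isT).
    by rewrite rmorph1 mul1r addrC subrK.
  have -> : 1 - y / xs t' = ((xs t - y) - (xs t - xs t')) * (xs t')^-1.
    have -> : (xs t - y) - (xs t - xs t') = xs t' - y by ring.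
    by rewrite mulrBl divrr.
  apply: le_trans (cnormM _ _) _.
  rewrite /K mulrAC; apply: ler_pM; rewrite ?cnorm_ge0//.
  rewrite (le_trans (cnormB _ _))// [leRHS]mulrDl lerD//; last first.
    by rewrite mulrC xB.
  by rewrite -[leRHS]mulrA [X in _ <= _ * X]mulrC.
(* Steps of length [1 / n.+1] are short enough to continue from [0] to [1]. *)
have [n Kn] : exists n : nat, K < n.+1%:R.
  exists (Num.bound K); rewrite (lt_trans (archi_boundP K0))// ltr_nat//.
suff : forall j, (j <= n.+1)%N -> let t := j%:R / n.+1%:R in
    cnewton1_to (xs t ^+ 2) (xs t).
  move=> /(_ _ (leqnn _)) /=; rewrite divff ?pnatr_eq0//.
  by rewrite /xs /csegment rmorph1 mul1r addrC subrK.
have n0 : 0 < n.+1%:R :> R by rewrite ltr0n.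
have t01 j : (j <= n.+1)%N -> 0 <= (j%:R / n.+1%:R : R) <= 1.
  by move=> jn; rewrite divr_ge0//= ler_pdivrMr// mul1r ler_nat.
elim=> [_ /=|j IHj jn /=].
  have -> : xs (0 / n.+1%:R) = 1.
    by rewrite /xs /csegment mul0r rmorph0 mul0r addr0.
  by exists 0 => k; rewrite expr1n cnewton11 subrr cnorm0 mul0r.
apply: (step (j%:R / n.+1%:R)); rewrite ?t01//; last exact: IHj (ltnW jn).
  exact: ltnW.
rewrite -mulrBl -normrN -mulNr opprB -natrB// subSnn mul1r.
rewrite ger0_norm ?invr_ge0 ?ler0n// ltr_pdivrMr//.
by rewrite (lt_trans Kn)// mulr_natl mulr2n ltrDl.
Qed.

(** After one step, the sign iteration from the limit [y] is [y^-1] times the iterates for [a]. So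
    it tends to [1], and [half_plane_newton] locates the spectrum of [y]. *)
Lemma cnewton1_root a :
  spectrum (csval a) `&` @nonpos_reals R = set0 ->
  exists y, [/\ y ^+ 2 = a, spectrum (csval y) `<=` @right_half_plane R &
    cnewton1_to a y].
Proof.
move=> spa; have aU := nonpos_segment_unit spa.
have [M aM] := segment_bounded aU.
have [y [y2 [C yC]]] := cnewton1_limit aU aM.
exists y; split=> //; last by exists C.
have yU : y \is a GRing.unit.
  by have := segment_unit1 aU; rewrite -y2 unitrX_pos.
have NE k : cnewton 1 y k.+1 = y^-1 * cnewton a 1 k.+1.
  by rewrite -y2 cnewton_sign// => j; rewrite y2 cnewton1_unit.
have NU k : cnewton 1 y k \is a GRing.unit.
  by case: k => [//|k]; rewrite NE unitrM unitrV yU cnewton1_unit.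
have [K yK] := @geometric_small _ (cnorm y^-1 * C) _ _ (half01 R) ltr01.
apply: (@half_plane_newton _ _ _ _ K.+1) => //.
have -> : 1 - cnewton 1 y K.+1 = y^-1 * (y - cnewton a 1 K.+1).
  by rewrite NE mulrBr mulVr.
apply: le_lt_trans (yK K.+1 (leqnSn _)).
by rewrite (le_trans (cnormM _ _))// -mulrA ler_wpM2l ?cnorm_ge0.
Qed.

End PrincipalRootLimit.

(** * Uniqueness of the principal root *)

Section PrincipalRootUniqueness.
Variables (R : realType) (A : banachAlgType R[i]).
Implicit Types a x y : A.

(** The iterates depend on [a] alone, so they determine the root. Each root is handled in its own
    subalgebra, as two roots are not assumed to commute. *)
Lemma psqrt_limit a x : is_psqrt a x ->
  exists C : R, forall k, rnorm (x - newton a 1 k) <= C * 2^-1 ^+ k.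
Proof.
move=> [<- spx]; have [|x' x'E] := @csubP R A [set x] x _ erefl.
  by move=> _ _ -> ->.
rewrite -x'E in spx *; have [C xC] := cnewton1_half_plane spx.
exists C => k.
have -> : newton (csval x' ^+ 2) 1 k = csval (cnewton (x' ^+ 2) 1 k).
  by rewrite csval_newton.
exact: xC.
Qed.

Lemma psqrt_eq a x : is_psqrt a x -> psqrt a = x.
Proof.
move=> ax; have := xgetPex 0 (ex_intro (is_psqrt a) x ax).
rewrite -/(psqrt a) => /psqrt_limit[C yC]; have [D xD] := psqrt_limit ax.
apply/eqP; rewrite -subr_eq0; apply/eqP/rnorm_eq0/le_anti.
rewrite rnorm_ge0 andbT; apply: (@geometric_le0 _ _ (C + D) _ (half01 R)) => k.
rewrite -(subrK (newton a 1 k) (psqrt a)) -addrA (le_trans (rnormD _ _))//.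
rewrite [leRHS]mulrDl; apply: lerD; first exact: yC.
by rewrite -rnormN opprB; exact: xD.
Qed.

End PrincipalRootUniqueness.

(** * The Cayley transform and the quadratic error formula *)

Section CayleyNewton.
Variables (R : realType) (A : banachAlgType R[i]) (E : set A).
Local Notation csub := (csub E).
Local Notation scal := (@scal R A E).
Implicit Types a s x X : csub.

(** A step [N -> (N + N^-1) / 2] squares [(N - 1) / (N + 1)]. The induction keeps this relation
    multiplied out, with [N + 1] invertible. *)
Lemma cnewton_cayley x k : x + 1 \is a GRing.unit ->
  (forall j, cnewton 1 x j \is a GRing.unit) ->
  let G := ((x - 1) * (x + 1)^-1) ^+ (2 ^ k) in
  1 - G \is a GRing.unit /\ cnewton 1 x k = (1 - G)^-1 * (1 + G).
Proof.
move=> x1U NU; set g := (x - 1) * _ => G; rewrite {}/G.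
have [NkU Nkg] : cnewton 1 x k + 1 \is a GRing.unit /\
    cnewton 1 x k - 1 = g ^+ (2 ^ k) * (cnewton 1 x k + 1).
  elim: k => [|k [IHU IHg]]; first by rewrite expn0 expr1 /g /= divrK.
  have NS := cnewton_step (NU k).
  have Np : 2 * cnewton 1 x k * (cnewton 1 x k.+1 + 1) =
      (cnewton 1 x k + 1) ^+ 2.
    by rewrite mulrDr NS; ring.
  have Nm : 2 * cnewton 1 x k * (cnewton 1 x k.+1 - 1) =
      (cnewton 1 x k - 1) ^+ 2.
    by rewrite mulrBr NS; ring.
  split.
    have : (cnewton 1 x k + 1) ^+ 2 \is a GRing.unit by rewrite unitrX.
    by rewrite -Np unitrM => /andP[].
  apply: (@mulrI _ (2 * cnewton 1 x k)); first by rewrite unitrM unit2 NU.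
  by rewrite Nm mulrCA Np IHg exprMn -exprM expnSr.
move: (cnewton 1 x k) (g ^+ _) NkU Nkg => N G N1U NG.
have GU : (N + 1) * (1 - G) = 2 by rewrite mulrBr mulr1 mulrC -NG; ring.
have G1U : 1 - G \is a GRing.unit.
  by have := @unit2 R A E; rewrite -GU unitrM => /andP[].
split=> //; apply: (mulrI G1U); rewrite mulrA divrr// mul1r.
have -> : (1 - G) * N = N + G - G * (N + 1) by ring.
by rewrite -NG; ring.
Qed.

Lemma cnewton_error a s X k : s ^+ 2 = a -> cnewton a X k \is a GRing.unit ->
  2 * (cnewton a X k.+1 - s) =
  (cnewton a X k)^-1 * (cnewton a X k - s) ^+ 2.
Proof.
move=> <- XU; rewrite mulrBr cnewtonS; set Y := cnewton _ _ _ in XU *.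
transitivity (Y * (Y^-1 * Y) - 2 * s * (Y^-1 * Y) + Y^-1 * s ^+ 2).
  by rewrite mulVr// !mulr1; ring.
by ring.
Qed.

End CayleyNewton.

(** * Newton's iteration from a commuting starting point *)

Theorem theorem4p2 (R : realType) (A : banachAlgType R[i]) (a X0 : A)
  (spa : spectrum a `&` @nonpos_reals R = set0)
  (commX0 : X0 * a = a * X0)
  (spX0 : spectrum ((psqrt a)^-1 * X0) `<=` @right_half_plane R) :
  let X := newton a X0 in
  let N := psqrt (((psqrt a)^-1 * X0) ^+ 2) in
  let S := signB ((psqrt a)^-1 * X0) in
  let G0 := cayley N in
  [/\ (forall k, X k \is a GRing.unit),
      X k @[k --> \oo] --> psqrt a,
      (X k)^-1 @[k --> \oo] --> (psqrt a)^-1,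
      (forall k, `|X k.+1 - psqrt a|
         <= 2^-1 * `|(X k)^-1| * `|X k - psqrt a| ^+ 2) &
      (forall k, (1 <= k)%N ->
         1 - G0 ^+ (2 ^ k) \is a GRing.unit /\
         X k = psqrt a * (1 - G0 ^+ (2 ^ k))^-1 * (1 + G0 ^+ (2 ^ k)) * S)].
Proof.
(* As [a] and [X0] commute, both lie in the bicommutant of the pair. *)
have [E [a' [Z [a'E ZE]]]] :
    exists (E : set A) (a' Z : csub E), csval a' = a /\ csval Z = X0.
  have comm e e' : [set a; X0] e -> [set a; X0] e' -> e * e' = e' * e.
    by move=> [->|->] [->|->].
  have [a' a'E] := csubP comm (or_introl erefl).
  have [Z ZE] := csubP comm (or_intror erefl).
  by exists [set a; X0], a', Z.
rewrite -{}a'E -{}ZE {commX0 a X0} in spa spX0 *.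
have [s [s2 sps _]] := cnewton1_root spa.
have sE : psqrt (csval a') = csval s by apply: psqrt_eq; rewrite -s2.
rewrite sE in spX0 *; set x := s^-1 * Z.
have {}spX0 : spectrum (csval x) `<=` @right_half_plane R by exact: spX0.
have aU := segment_unit1 (nonpos_segment_unit spa).
have sU : s \is a GRing.unit by rewrite -s2 unitrX_pos in aU.
(* This makes [N] equal to [x], and the sign [S] equal to [1]. *)
have xE : psqrt (csval x ^+ 2) = csval x by apply: psqrt_eq.
have unit_x l : complex.Re l <= 0 -> x - scal E l \is a GRing.unit.
  move=> l0; apply: contrapT => /negP/spX0; rewrite /right_half_plane /=.
  by rewrite ltNge l0.
have xU : x \is a GRing.unit by have := unit_x 0; rewrite rmorph0 subr0; apply.
have x1U : x + 1 \is a GRing.unit.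
  have := unit_x (- 1); rewrite rmorphN rmorph1 opprK; apply.
  by rewrite /= lerN10.
have x2U : segment_unit (x ^+ 2).
  move=> t t01; have := csegment_unit (t := 1) spX0 _ t01.
  rewrite (_ : csegment x 1 = x) ?ler01 ?lexx; first exact.
  by rewrite /csegment rmorph1 mul1r addrC subrK.
have x2C := cnewton1_half_plane spX0.
have NE k : cnewton 1 x k.+1 = x^-1 * cnewton (x ^+ 2) 1 k.+1.
  by apply: cnewton_sign => // j; exact: cnewton1_unit.
have NU k : cnewton 1 x k \is a GRing.unit.
  by case: k => [//|k]; rewrite NE unitrM unitrV xU cnewton1_unit.
have ZE k : cnewton a' Z k = s * cnewton 1 x k.
  rewrite -(cnewton_scale k sU NU) s2 mulr1; congr cnewton.
  by rewrite /x mulrA divrr// mul1r.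
have ZU k : cnewton a' Z k \is a GRing.unit by rewrite ZE unitrM sU NU.
move=> X N S G0.
have XE k : X k = csval (cnewton a' Z k) by rewrite csval_newton.
(* The bound starts at index [k.+1], since the comparison [NE] with the iteration for [x ^+ 2]
   starts after one step. *)
have [C sC] : exists C : R, forall k,
    cnorm (cnewton a' Z k.+1 - s) <= C * 2^-1 ^+ k.+1.
  have [C xC] := x2C; exists (cnorm (s * x^-1) * C) => k.
  have -> : cnewton a' Z k.+1 - s =
      - (s * x^-1 * (x - cnewton (x ^+ 2) 1 k.+1)).
    by rewrite ZE NE mulrBr divrK// opprB mulrA.
  by rewrite cnormN (le_trans (cnormM _ _))// -mulrA ler_wpM2l ?cnorm_ge0.
have small (c e : R) : 0 < e -> exists K, forall k, (K <= k)%N ->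
    c * cnorm (cnewton a' Z k - s) < e /\ cnorm (cnewton a' Z k - s) < e.
  move=> e0.
  (* The factor [|c| + 1] dominates both [c] and [1], so one index serves both inequalities. *)
  have [K KC] := geometric_small ((`|c| + 1) * C) (half01 R) e0.
  exists K.+1 => -[//|k] /ltnW/KC; set d := cnorm _ => kC.
  have d0 : 0 <= d by exact: cnorm_ge0.
  have cd : (`|c| + 1) * d < e.
    by rewrite (le_lt_trans _ kC)// -mulrA ler_wpM2l// ?sC// addr_ge0.
  by split; apply: le_lt_trans cd; rewrite ?ler_wpM2r ?ler_peMl ?lerDr//
    (le_trans (ler_norm _))// lerDl.
split.
- by move=> k; rewrite XE; exact: ZU.
- apply: rnorm_cvg => e /(small 0)[K Ke]; exists K => k /Ke[_].
  by rewrite XE.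
- apply: rnorm_cvg => e e0; set M := cnorm s^-1.
  have half_gt0 : 0 < 2^-1 :> R by rewrite invr_gt0.
  (* Past [K] the inverses are bounded by [2 * M]; past [K'] their distance to [s^-1], at most
     [(2 M)^2] times the error, is below [e]. *)
  have [K KM] := small M _ half_gt0.
  have [K' KM'] := small (2 * M * (2 * M)) e e0.
  exists (maxn K K') => k; rewrite geq_max => /andP[/KM[kM _] /KM'[kM' _]].
  rewrite XE; apply: le_lt_trans kM'; rewrite [X in _ <= _ * X]cnormC.
  apply: cnorm_subV; rewrite ?ZU//.
    by apply: (cnormV_le sU) => //; rewrite mulrC ltW.
  by rewrite mulr_natl mulr2n lerDl cnorm_ge0.
- move=> k; rewrite !XE.
  have := cnewton_error s2 (ZU k).
  move/(congr1 (@cnorm _ _ _)); rewrite cnorm2 => Xk.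
  have {Xk} : 2 * cnorm (cnewton a' Z k.+1 - s) <=
      cnorm (cnewton a' Z k)^-1 * cnorm (cnewton a' Z k - s) ^+ 2.
    rewrite Xk (le_trans (cnormM _ _))// ler_wpM2l ?cnorm_ge0//.
    by rewrite !expr2 cnormM.
  rewrite -ler_pdivlMl// => Xk.
  rewrite !rnormE -[2^-1](_ : (2^-1)%:C = _); last first.
    by rewrite fmorphV rmorph_nat.
  by rewrite -rmorphXn -!rmorphM/= lecR -mulrA.
move=> k _; have [GU GE] := cnewton_cayley k x1U NU.
have -> : G0 = csval ((x - 1) * (x + 1)^-1) by rewrite /G0 /N xE.
have -> : S = 1.
  by rewrite /S /signB xE; have := mulrV xU => /(congr1 (@csval _ _ _)).
rewrite mulr1 -csvalX; split; first exact: GU.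
by rewrite XE ZE GE mulrA.
Qed.
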